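(* Let $F$ be a field and let $A$ be a finite dimensional unital associative $F$-algebra. Let $E$ be the subalgebra of $A$ generated by all idempotents of $A$, and let $I$ be the (two-sided) ideal of $A$ generated by all commutators of idempotents of $A$ with arbitrary elements of $A$. Let $R$ be the Jacobson radical of $A$. Let $e$ be an idempotent in $A$. Then the following statements are equivalent: (1) the projective $A$-module $Ae$ is zad; (2) $Ae/Re$ is zad and $Re\subseteq Ie$; (3) $Ae/Re$ is zad and every $1$-dimensional quotient module $S$ of $Ae$ satisfies $\operatorname{Ext}_A^1(S,S)=0$; (4) $Ae=Ee$.
   Context: All modules are unital left modules; dimensions are over $F$. An $A$-module $V$ is called zero action determined (zad) if for every $F$-bilinear map $f: A\times V\to F$ with the property that $f(a,m)=0$ whenever $a\in A$, $m\in V$ and $am=0$, there exists a linear map $\Phi: V\to F$ such that $f(x,v)=\Phi(xv)$ for all $x\in A$, $v\in V$. The commutator is $[x,y]=xy-yx$. *)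

(* Defs.v *)
From HB Require Import structures.
From mathcomp Require Import all_boot all_algebra all_field.
From mathcomp Require Import boolp classical_sets.

Set Implicit Arguments.
Unset Strict Implicit.
Unset Printing Implicit Defensive.

Import GRing.Theory.

Local Open Scope classical_set_scope.
Local Open Scope quotient_scope.
Local Open Scope ring_scope.

(* GRing.submodClosed, stated over semirings, lacks closure under opposite. *)
Record submodule (A : nzRingType) (V : lmodType A) := Submodule {
  submodule_pred :> {pred V};
  submoduleP : submod_closed submodule_pred
}.

HB.instance Definition _ (A : nzRingType) (V : lmodType A) (S : submodule V) :=
  GRing.isSubmodClosed.Build A V (submodule_pred S) (submoduleP S).

Section QuotientModule.
Variables (A : nzRingType) (V : lmodType A) (S : submodule V).

Definition quot_mod : Type := Quotient.quot S.
HB.instance Definition _ := GRing.Zmodule.on quot_mod.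

Definition quot_pi (v : V) : quot_mod := \pi_(Quotient.quot S) v.

Fact quot_piE (u v : V) : (quot_pi u == quot_pi v) = (u - v \in S).
Proof. exact/esym/(Quotient.idealrBE S u v). Qed.

Fact quot_piP (P : quot_mod -> Prop) : (forall v, P (quot_pi v)) -> forall x, P x.
Proof. by move=> Ppi x; rewrite -[x](@reprK _ (Quotient.quot S)); apply: Ppi. Qed.

Fact quot_piD : {morph quot_pi : u v / u + v}.
Proof. exact: (raddfD (\pi_(Quotient.quot S))). Qed.

Definition quot_scale (a : A) (x : quot_mod) : quot_mod :=
  quot_pi (a *: repr (x : Quotient.quot S)).

Fact quot_piZ (a : A) (v : V) : quot_scale a (quot_pi v) = quot_pi (a *: v).
Proof.
apply/eqP; rewrite quot_piE -scalerBr rpredZ //.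
by rewrite -quot_piE; apply/eqP; apply: (@reprK _ (Quotient.quot S)).
Qed.

Fact quot_scalerA (a b : A) (x : quot_mod) :
  quot_scale a (quot_scale b x) = quot_scale (a * b) x.
Proof. by elim/quot_piP: x => v; rewrite !quot_piZ scalerA. Qed.

Fact quot_scale1r : left_id 1 quot_scale.
Proof. by elim/quot_piP=> v; rewrite quot_piZ scale1r. Qed.

Fact quot_scalerDr : right_distributive quot_scale +%R.
Proof.
move=> a; elim/quot_piP=> v; elim/quot_piP=> w.
by rewrite -quot_piD !quot_piZ scalerDr quot_piD.
Qed.

Fact quot_scalerDl (x : quot_mod) : {morph quot_scale^~ x : a b / a + b}.
Proof. by elim/quot_piP: x => v a b; rewrite !quot_piZ scalerDl quot_piD. Qed.

HB.instance Definition _ := GRing.Zmodule_isLmodule.Build A quot_mod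
  quot_scalerA quot_scale1r quot_scalerDr quot_scalerDl.

Fact quot_pi_linear : linear quot_pi.
Proof. by move=> a u v; rewrite quot_piD -quot_piZ. Qed.
HB.instance Definition _ :=
  GRing.isLinear.Build A V quot_mod _ quot_pi quot_pi_linear.

End QuotientModule.

Section SubModule.
Variables (A : nzRingType) (V : lmodType A) (S : submodule V).

Inductive sub_mod : predArgType := SubMod (v : V) of v \in S.
Definition sub_mod_val (u : sub_mod) : V := let: SubMod v _ := u in v.

HB.instance Definition _ := [isSub of sub_mod for sub_mod_val].
HB.instance Definition _ := [Choice of sub_mod by <:].
HB.instance Definition _ := [SubChoice_isSubZmodule of sub_mod by <:].
HB.instance Definition _ := [SubZmodule_isSubLmodule of sub_mod by <:].

End SubModule.

Section Ext.
Variable A : nzRingType.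

Definition projective (P : lmodType A) : Prop :=
  forall (M N : lmodType A) (g : {linear M -> N}) (f : {linear P -> N}),
    (forall y, exists x, g x = y) ->
    exists h : {linear P -> M}, forall p, g (h p) = f p.

(* ... -> P 2 -> P 1 -> P 0 -> M -> 0, with d i : P i.+1 -> P i *)
Definition projective_resolution (M : lmodType A) (P : nat -> lmodType A)
    (d : forall i, {linear P i.+1 -> P i}) (eps : {linear P 0%N -> M}) : Prop :=
  [/\ forall i, projective (P i),
      forall m, exists p, eps p = m,
      forall p, eps p = 0 <-> exists q, d 0%N q = p &
      forall i p, d i p = 0 <-> exists q, d i.+1 q = p].

(* Ext^{n+1}_A(M, N) = 0, where Ext^{n+1}_A(M, N) is the cohomology at
   Hom(P (n+1), N) of Hom(P, N); it does not depend on the resolution P. *)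
Definition ExtS_eq0 (n : nat) (M N : lmodType A) : Prop :=
  forall (P : nat -> lmodType A) (d : forall i, {linear P i.+1 -> P i})
         (eps : {linear P 0%N -> M}),
    projective_resolution d eps ->
    forall g : {linear P n.+1 -> N}, (forall p, g (d n.+1 p) = 0) ->
    exists h : {linear P n -> N}, forall p, g p = h (d n p).

Definition Ext1_eq0 : lmodType A -> lmodType A -> Prop := ExtS_eq0 0.

End Ext.

Section Algebra.
Variables (F : fieldType) (A : falgType F).

(* F acts on an A-module through k |-> k%:A. *)
Definition Flinear (V : lmodType A) (g : V -> F) : Prop :=
  forall (k : F) (u v : V), g (k%:A *: u + v) = k * g u + g v.

Definition Fbilinear (V : lmodType A) (f : A -> V -> F) : Prop :=
  (forall v, scalar (f^~ v)) /\ (forall a, Flinear (f a)).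

Definition zad (V : lmodType A) : Prop :=
  forall f : A -> V -> F, Fbilinear f ->
    (forall (a : A) (m : V), a *: m = 0 -> f a m = 0) ->
    exists2 Phi : V -> F, Flinear Phi &
      forall (x : A) (v : V), f x v = Phi (x *: v).

(* V has an F-basis consisting of one vector. *)
Definition one_dimensional (V : lmodType A) : Prop :=
  exists2 s : V, s != 0 & forall v : V, exists k : F, v = k%:A *: s.

Definition idempotents : set A := [set p | p * p = p].

Definition idem_subalg : set A :=
  smallest [set B : set A | subalg_closed (mem B)] idempotents.

(* Left ideals are the submodules of the regular left module A^o. *)
Definition left_ideal (J : set A) : Prop := submod_closed (mem J : {pred A^o}).

Definition two_sided_ideal (J : set A) : Prop :=
  left_ideal J /\ forall x a : A, J x -> J (x * a).

Definition comm_ideal : set A :=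
  smallest two_sided_ideal
    [set c | exists2 p : A, idempotents p & exists x : A, c = p * x - x * p].

Definition maximal_left_ideal (M : set A) : Prop :=
  [/\ left_ideal M, M <> setT &
      forall J, left_ideal J -> M `<=` J -> J = M \/ J = setT].

Definition jacobson : set A := \bigcap_(M in maximal_left_ideal) M.

Definition rtrans (S : set A) (e : A) : set A := [set x * e | x in S].

Fact principal_closed e : submod_closed (mem (rtrans setT e) : {pred A^o}).
Proof.
split=> [|a u v]; rewrite ?inE; first by exists 0; rewrite ?mul0r.
case=> x _ <- [y _ <-]; exists (a * x + y) => //.
by rewrite mulrDl -mulrA.
Qed.

Definition Ae (e : A) : lmodType A := sub_mod (Submodule (principal_closed e)).

Definition Re_pred (e : A) : {pred Ae e} :=
  [pred u : Ae e | (sub_mod_val u : A) \in rtrans jacobson e].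

Fact jacobson_left_ideal : left_ideal jacobson.
Proof.
split=> [|a u v]; rewrite !inE.
  by move=> M /= [[M0 _] _ _]; rewrite inE in M0.
move=> Ju Jv M Mmax; have [[_ Mlin] _ _] := Mmax.
by have := Mlin a u v; rewrite !inE; apply; [apply: Ju | apply: Jv].
Qed.

Fact Re_closed e : submod_closed (@Re_pred e).
Proof.
have [J0 Jlin] := jacobson_left_ideal; split=> [|a u v].
  by rewrite !inE; exists 0; rewrite ?mul0r //; rewrite inE in J0.
rewrite !inE => -[x Jx xe] [y Jy ye]; exists (a * x + y).
  by have := Jlin a x y; rewrite !inE; apply.
by rewrite mulrDl -mulrA xe ye.
Qed.

Definition Ae_mod_Re (e : A) : lmodType A := quot_mod (Submodule (@Re_closed e)).

End Algebra.

Arguments idem_subalg {F} A.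
Arguments comm_ideal {F} A.
Arguments jacobson {F} A.

(* Main.v *)
From HB Require Import structures.
Require Import Defs.
From mathcomp Require Import all_boot all_algebra all_field.
From mathcomp Require Import ring boolp classical_sets.

(** Write I for the ideal generated by commutators with idempotents, E for the
subalgebra generated by idempotents and R for the radical.

Three facts carry the proof.  Since [uv,x] = [u,vx] + [v,xu], the subalgebra E
is a Lie ideal, and as [p,x] = [p,[p,[p,x]]] it contains I
([comm_ideal_sub_idem_subalg]).  A finite dimensional algebra is an exchange
ring ([exchange]): corners pAp at primitive idempotents are local, and every
idempotent is a sum of primitive ones, so that statements additive in e have
to be checked only at primitive idempotents p below e.  For such a p, the
off-diagonal parts pA(1-p) and (1-p)Ap lie in I, so modulo I the module Ap is
the local ring pAp.

If Ae = Ee then Ae is zad, because a bilinear map f that sees zero products is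
E-balanced: f(xp, (1-p)v) = 0 = f(x(1-p), pv) gives f(xp, v) = f(x, pv)
([zad_of_generated]).

Conversely a zad quotient of Ae leaves no room above the scalars in the corner
pAp modulo I: if a functional rho kills I and p but not xp, and alpha is a
functional vanishing on the non-units of pAp with alpha(p) = 1, then
f(a,v) = alpha(pap) rho(pv) sees zero products but is not of the form Phi(av)
([zad_primitive_functional]).  For Ae itself this gives Ap = Fp + Ip, and an
element of Rp with a nonzero scalar part would force p into I, whence
Re inside Ie ([zad_radical_sub]).  For Ae/Re it gives Ap = Fp + Ip + Rp.

Let S be a one-dimensional quotient of Ae, with character chi.  An idempotent
acts on any self-extension X of S by 0 or 1, so I kills X; so does 1-e, hence
so does R when Re is inside Ie.  The kernel of chi is spanned modulo R by
elements a(1-p) and (1-p)ap, where p is primitive with chi(p) = 1, and these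
also kill X.  Thus A acts on X through chi and X splits
([quotient_Ext1_eq0]).

Finally assume Ap = Fp + Ip + Rp with p outside I.  Then a |-> ap modulo
Ip + Rp is a character of A, attached to a one-dimensional quotient S of Ae.
Let K be its kernel; K = T + R where T consists of the a with ap in I.  A
functional on K that vanishes on KK is an A-linear map K -> S, so
Ext^1(S,S) = 0 means K = KK, and then K is contained in T + RK.  By Nakayama
K = T, that is Ap = Fp + Ip, which lies in E ([corner_generated]). *)

Set Implicit Arguments.
Unset Strict Implicit.
Unset Printing Implicit Defensive.

Import GRing.Theory.

Local Open Scope classical_set_scope.
Local Open Scope ring_scope.

(** * Subspaces and linear functionals *)

Section Subspaces.
Variables (F : fieldType) (V : vectType F).

(** Finite dimension as an induction principle: the source of every maximal
object below, namely maximal left ideals, bases of sets and submodules. *)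
Lemma max_vspace (Q : {vspace V} -> Prop) (U0 : {vspace V}) : Q U0 ->
  exists U, [/\ Q U, (U0 <= U)%VS & forall U', Q U' -> (U <= U')%VS -> U' = U].
Proof.
move=> QU0.
pose P n := `[< exists U, [/\ Q U, (U0 <= U)%VS & \dim U = n] >].
have exP : exists n, P n by exists (\dim U0); apply/asboolP; exists U0.
have leP n : P n -> (n <= dim V)%N.
  by case/asboolP=> U [_ _ <-]; rewrite -dimvf dimvS ?subvf.
case: (ex_maxnP exP leP) => n /asboolP[U [QU U0U <-]] maxn.
exists U; split=> // U' QU' UU'; apply/esym/eqP; rewrite eqEdim UU' maxn //.
by apply/asboolP; exists U'; split=> //; apply: subv_trans UU'.
Qed.

Definition subspace_set (K : set V) : Prop :=
  K 0 /\ forall (k : F) u v, K u -> K v -> K (k *: u + v).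

Lemma subspace_vspace (K : set V) : subspace_set K ->
  exists U : {vspace V}, forall v, v \in U <-> K v.
Proof.
move=> [K0 Kl].
pose Q (U : {vspace V}) := forall v, v \in U -> K v.
have Q0 : Q 0%VS by move=> v; rewrite memv0 => /eqP->.
have [U [QU _ maxU]] := max_vspace Q0; exists U => v; split; first exact: QU.
move=> Kv; rewrite -(maxU (U + <[v]>)%VS) ?addvSl //.
  by apply: (subvP (addvSr _ _)); apply: memv_line.
move=> w /memv_addP[u /QU Ku [_ /vlineP[k ->] ->]]; rewrite addrC; exact: Kl.
Qed.

Lemma separating_functional (K : set V) (v : V) : subspace_set K -> ~ K v ->
  exists l : {scalar V}, (forall u, K u -> l u = 0) /\ l v = 1.
Proof.
move=> /subspace_vspace[U UK] nKv.
have dU : (U^C :&: U = 0)%VS by rewrite capvC capv_compl.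
pose w := daddv_pi U^C U; pose b := vbasis {:V}.
have w0 u : u \in U -> w u = 0.
  move=> uU; have := daddv_pi_add dU (w := u); rewrite addvC addv_complf memvf.
  have dU' : (U :&: U^C = 0)%VS by rewrite capv_compl.
  rewrite (daddv_pi_id dU' uU) => /(_ isT) /(congr1 (fun x => x - u)).
  by rewrite addrK subrr.
have wv : w v != 0.
  apply/eqP=> wv0; apply: nKv; apply/UK.
  have := daddv_pi_add dU (w := v); rewrite addvC addv_complf memvf => /(_ isT) <-.
  by rewrite -/w wv0 add0r memv_pi.
have [i ci] : exists i, coord b i (w v) != 0.
  apply: contrapT => nex; case/eqP: wv; rewrite (coord_vbasis (memvf (w v))).
  apply: big1 => i _; case: (eqVneq (coord b i (w v)) 0) => [->|ci].
    by rewrite scale0r.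
  by case: nex; exists i.
pose f u := (coord b i (w v))^-1 * coord b i (w u).
have fl : scalar f.
  by move=> k x y; rewrite /f !linearP /= mulrDr mulrCA.
pose fL := GRing.isLinear.Build F V F *%R f fl.
pose l : {scalar V} := HB.pack f fL.
exists l; split=> [u /UK /w0 wu|]; rewrite /l /= /f ?mulVf //.
by rewrite wu linear0 mulr0.
Qed.

End Subspaces.

(** * Left ideals and the radical *)

Section LeftIdeals.
Variables (F : fieldType) (A : falgType F).
Implicit Types (J K M : set A) (a b x y : A).

Lemma left_idealP J :
  left_ideal J <-> J 0 /\ forall a x y, J x -> J y -> J (a * x + y).
Proof.
rewrite /left_ideal; split=> -[J0 Jl]; split; move: J0; rewrite ?inE //.
  by move=> _ a x y Jx Jy; have := Jl a x y; rewrite !inE; apply.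
by move=> _ a x y; rewrite !inE; apply: Jl.
Qed.

Lemma left_ideal0 J : left_ideal J -> J 0.
Proof. by case/left_idealP. Qed.

Lemma left_idealD J x y : left_ideal J -> J x -> J y -> J (x + y).
Proof. by case/left_idealP=> _ Jl Jx Jy; rewrite -[x]mul1r; apply: Jl. Qed.

Lemma left_idealM J a x : left_ideal J -> J x -> J (a * x).
Proof. by case/left_idealP=> J0 Jl Jx; rewrite -[a * x]addr0; apply: Jl. Qed.

Lemma left_idealN J x : left_ideal J -> J x -> J (- x).
Proof. by move=> Jl Jx; rewrite -mulN1r; apply: left_idealM. Qed.

Lemma left_idealB J x y : left_ideal J -> J x -> J y -> J (x - y).
Proof. by move=> Jl Jx Jy; apply: left_idealD => //; apply: left_idealN. Qed.

Lemma left_idealZ J (k : F) x : left_ideal J -> J x -> J (k *: x).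
Proof. by move=> Jl Jx; rewrite -mulr_algl; apply: left_idealM. Qed.

Lemma left_ideal_subspace J : left_ideal J -> subspace_set J.
Proof.
move=> Jl; split=> [|k x y Jx Jy]; first exact: left_ideal0.
by apply: left_idealD => //; apply: left_idealZ.
Qed.

Definition add_principal J b : set A := [set x | exists a, J (x - a * b)].

Lemma add_principal_left_ideal J b : left_ideal J -> left_ideal (add_principal J b).
Proof.
move=> Jl; apply/left_idealP; split=> [|a x y [c Jx] [d Jy]].
  by exists 0; rewrite mul0r subr0; apply: left_ideal0.
exists (a * c + d); rewrite mulrDl opprD addrACA -mulrA -mulrBr.
by apply: left_idealD => //; apply: left_idealM.
Qed.

Lemma sub_add_principal J b : J `<=` add_principal J b.
Proof. by move=> x Jx; exists 0; rewrite mul0r subr0. Qed.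

Lemma mem_add_principal J b : left_ideal J -> add_principal J b b.
Proof. by move=> Jl; exists 1; rewrite mul1r subrr; apply: left_ideal0. Qed.

(** Left ideals are F-subspaces, so an arbitrary property of sets may be
maximised over them without any chain condition on the property. *)
Lemma max_left_ideal (Q : set A -> Prop) J0 : left_ideal J0 -> Q J0 ->
  exists J, [/\ left_ideal J, Q J, J0 `<=` J &
    forall K, left_ideal K -> Q K -> J `<=` K -> K = J].
Proof.
move=> J0l QJ0.
pose Q' (U : {vspace A}) := left_ideal [set x | x \in U] /\ Q [set x | x \in U].
have ofl J : left_ideal J -> exists2 U : {vspace A}, J = [set x | x \in U] & True.
  move=> /left_ideal_subspace /subspace_vspace[U UJ]; exists U => //.
  by apply/seteqP; split=> x /UJ.
have [U0 eJ0 _] := ofl _ J0l; rewrite {}eJ0 in J0l QJ0 *.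
have [U [[Ul QU] U0U maxU]] := @max_vspace _ _ Q' U0 (conj J0l QJ0).
exists [set x | x \in U]; split=> //; first exact/subvP.
move=> K Kl QK UK; have [W eK _] := ofl _ Kl; rewrite {}eK in Kl QK UK *.
by rewrite (maxU W) //; apply/subvP.
Qed.

Lemma left_ideal_zero : left_ideal [set (0 : A)].
Proof. by apply/left_idealP; split=> // a x y -> ->; rewrite mulr0 addr0. Qed.

Lemma exists_maximal_left_ideal J : left_ideal J -> ~ J 1 ->
  exists2 M, maximal_left_ideal M & J `<=` M.
Proof.
move=> Jl nJ1; have [M [Ml nM1 JM maxM]] := max_left_ideal (Q := fun K => ~ K 1) Jl nJ1.
exists M => //; split=> // [MT|K Kl MK]; first by apply: nM1; rewrite MT.
have [K1|nK1] := pselect (K 1); [right | by left; apply: maxM].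
by apply/seteqP; split=> // x _; rewrite -[x]mulr1; apply: left_idealM.
Qed.

(** Otherwise A(1 - r) would lie in a maximal left ideal, which also contains
r and hence 1. *)
Lemma jacobson_quasi_regular r : jacobson A r -> exists y, y * (1 - r) = 1.
Proof.
move=> Rr; apply: contrapT => nex.
pose J := add_principal [set 0] (1 - r).
have Jl : left_ideal J := add_principal_left_ideal (1 - r) left_ideal_zero.
have [|M Mmax JM] := exists_maximal_left_ideal Jl.
  by case=> a /= /eqP; rewrite subr_eq0 => /eqP e1; apply: nex; exists a.
have [Ml MT _] := Mmax; apply: MT; apply/seteqP; split=> // x _.
have M1 : M 1.
  rewrite -[1](subrK r); apply: left_idealD => //; last exact: Rr.
  exact/JM/mem_add_principal/left_ideal_zero.
by rewrite -[x]mulr1; apply: left_idealM.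
Qed.

Lemma left_ideal_quasi_regular (J : set A) r x :
  left_ideal J -> jacobson A r -> J (x - r * x) -> J x.
Proof.
move=> Jl /jacobson_quasi_regular[y y1] Jx.
by rewrite -[x]mul1r -y1 -mulrA mulrBl mul1r; apply: left_idealM.
Qed.

(** If x is outside a maximal left ideal M then M + Ax = A, so 1 - ax lies in
M for some a; so it suffices to deduce from this that x is in M. *)
Lemma mem_jacobson x :
  (forall M a, maximal_left_ideal M -> M (1 - a * x) -> M x) -> jacobson A x.
Proof.
move=> H M Mmax; apply: contrapT => nMx; have [Ml MT maxM] := Mmax.
have [eM|eT] := maxM _ (add_principal_left_ideal x Ml) (@sub_add_principal M x).
  by apply: nMx; rewrite -eM; apply: mem_add_principal.
have [a Ma] : add_principal M x 1 by rewrite eT.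
exact/nMx/(H _ a).
Qed.

(** Nakayama in the form: K inside T + RK forces K inside T, where T + RK is
described by the left ideals that contain it.  Between T and K take M maximal
among left ideals not containing K.  If rv is outside M then M + Arv = K, so
v - arv is in M and quasi-regularity of ar puts v, hence rv, in M. *)
Lemma nakayama T K : left_ideal T -> left_ideal K -> T `<=` K ->
  (forall J, left_ideal J -> T `<=` J ->
     (forall r v, jacobson A r -> K v -> J (r * v)) -> K `<=` J) ->
  K `<=` T.
Proof.
move=> Tl Kl TK gen; apply: contrapT => nKT.
have [M [Ml [MK nKM] TM maxM]] :=
  max_left_ideal (Q := fun J => J `<=` K /\ ~ K `<=` J) Tl (conj TK nKT).
apply: nKM; apply: gen => // r v Rr Kv; apply: contrapT => nMrv.
have [a Ma] : add_principal M (r * v) v; last first.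
  apply: nMrv; apply: left_idealM => //.
  apply: (left_ideal_quasi_regular (r := a * r) Ml); last by rewrite -mulrA.
  exact: left_idealM (jacobson_left_ideal A) Rr.
apply: contrapT => nv; apply: nMrv.
rewrite -(maxM _ (add_principal_left_ideal (r * v) Ml)).
- exact: mem_add_principal.
- split=> [x [a Mx]|/(_ v Kv)//].
  rewrite -(subrK (a * (r * v)) x); apply: left_idealD => //; first exact: MK.
  by do 2!apply: left_idealM => //.
- exact: sub_add_principal.
Qed.

End LeftIdeals.

(** * Idempotents *)

Section Idempotents.
Variables (F : fieldType) (A : falgType F).
Implicit Types (p q u x y z : A).

Lemma annihilating_poly y : exists2 P : {poly F}, P != 0 & horner_alg y P = 0.
Proof.
pose X := [tuple y ^+ i | i < (dim A).+1].
have nfree : ~~ free X.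
  rewrite /free size_tuple neq_ltn ltnS -[X in (_ <= X)%N]dimvf.
  by rewrite dimvS ?subvf.
apply: contrapT => nex; case/negP: nfree; apply/freeP => k k0 i.
apply: contrapT => ki; apply: nex; exists (\poly_(j < (dim A).+1) k (inord j)).
  apply/eqP=> /(congr1 (coefp i)); rewrite /= coef_poly ltn_ord inord_val coef0.
  exact: ki.
rewrite poly_def linear_sum /= -[RHS]k0; apply: eq_bigr => j _.
rewrite linearZ /= rmorphXn /= horner_algX inord_val -(tnth_nth 0 X) tnth_mktuple.
by rewrite mulr_algl.
Qed.

(** Write an annihilating polynomial of y as X^m Q with Q(0) nonzero.  Then
X^(m+1) and Q (1 - X) are coprime with product killing y, and a Bezout relation
evaluated at y splits 1 into two complementary idempotents.  The additional
factors X and 1 - X make one a multiple of y and the other one of 1 - y. *)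
Lemma exchange y : exists p, [/\ p * p = p, exists2 z, p = z * y & p = y * z
  & exists w, 1 - p = w * (1 - y)].
Proof.
have [P P0 Py] := annihilating_poly y.
have [m [Q rQ eP]] := multiplicity_XsubC P 0; rewrite P0 /= in rQ.
rewrite polyC0 subr0 in eP.
have co : coprimep ('X ^+ m.+1) (Q * (1 - 'X)).
  apply: coprimep_expl; rewrite coprimep_sym -['X]subr0 -polyC0 coprimep_XsubC.
  by rewrite rootM negb_or rQ polyC0 subr0 /root !hornerE subr0 oner_eq0.
have [[u v] /= Buv] := Bezout_eq1_coprimepP _ _ co.
pose h : {rmorphism {poly F} -> A} := horner_alg y.
have Ph : h P = 0 by [].
have hX : h 'X = y by exact: horner_algX.
have h1 : h (u * 'X ^+ m.+1) + h (v * (Q * (1 - 'X))) = 1.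
  by rewrite -rmorphD Buv rmorph1.
exists (h (u * 'X ^+ m.+1)); split.
- have : h (u * 'X ^+ m.+1) * h (v * (Q * (1 - 'X))) = 0.
    rewrite -rmorphM.
    have -> : u * 'X ^+ m.+1 * (v * (Q * (1 - 'X))) = u * v * 'X * (1 - 'X) * P.
      by rewrite eP exprS; ring.
    by rewrite rmorphM Ph mulr0.
  move/(congr1 (+%R (h (u * 'X ^+ m.+1) * h (u * 'X ^+ m.+1)))); rewrite addr0.
  by rewrite -mulrDr h1 mulr1.
- exists (h (u * 'X ^+ m)).
    by rewrite -[X in _ = _ * X]hX -rmorphM; congr (h _); rewrite exprS; ring.
  by rewrite -[X in _ = X * _]hX -rmorphM; congr (h _); rewrite exprS; ring.
- exists (h (v * Q)); rewrite -{1}h1 addrC addKr mulrA rmorphM.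
  by rewrite (rmorphB h) rmorph1 hX.
Qed.

Definition primitive p : Prop :=
  [/\ p * p = p, p <> 0
    & forall q, q * q = q -> p * q = q -> q * p = q -> q = 0 \/ q = p].

(** The corner pAp is local: the idempotent supplied by exchange must be 0 or p. *)
Lemma primitive_local p y : primitive p -> p * y = y -> y * p = y ->
  (exists z, z * y = p) \/ (exists z, z * (p - y) = p).
Proof.
move=> [pp p0 prim] py yp.
have [q [qq [z q1 q2] [w qw]]] := exchange y.
have [|| q0 | qp] := prim q qq; first by rewrite q2 mulrA py.
- by rewrite q1 -mulrA yp.
- right; exists w; move/(congr1 ( *%R^~ p)): qw.
  by rewrite q0 subr0 mul1r -mulrA mulrBl yp mul1r => <-.
- by left; exists z; rewrite -q1.
Qed.

(** A non-unit b of the local corner cannot help to generate p: if p lies in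
M + Ab then p is already in M, since p - pab is invertible in the corner. *)
Lemma primitive_absorb p (M : set A) a b : primitive p -> left_ideal M ->
  b * p = b -> M (p - a * b) -> ~ (exists z, z * b = p) -> M p.
Proof.
move=> prim Ml bp Mpab nz; have [pp _ _] := prim.
have [||[z zy]|[z <-]] := @primitive_local p (p * a * b) prim.
- by rewrite !mulrA pp.
- by rewrite -[LHS]mulrA bp.
- by case: nz; exists (z * (p * a)); rewrite -[RHS]zy !mulrA.
- apply: left_idealM => //; rewrite -{1}pp -mulrA -mulrBr.
  exact: left_idealM.
Qed.

(** Splitting e = p + (e - p) at a non-primitive idempotent lowers the dimension
of Ae, so an additive property of idempotents reduces to the primitive ones
below e. *)
Lemma idempotent_induction (P : A -> Prop) e : e * e = e -> P 0 ->
    (forall p q, P p -> P q -> P (p + q)) ->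
    (forall p, primitive p -> e * p = p -> p * e = p -> P p) ->
  P e.
Proof.
move=> ee P0 PD Pprim.
suff IH n f : f * f = f -> e * f = f -> f * e = f ->
    (\dim (fullv * <[f]> : {vspace A})%VS < n)%N -> P f.
  exact: (IH _ e ee ee ee (ltnSn _)).
elim: n f => // n IHn f ff ef fe le_f_n.
have [->//|/eqP f0] := eqVneq f 0.
have [prim|nprim] := pselect (primitive f); first exact: Pprim.
have [p [pp fp pf p0 pnf]] :
    exists p, [/\ p * p = p, f * p = p, p * f = p, p <> 0 & p <> f].
  apply: contrapT => nex; apply: nprim; split=> // p pp fp pf.
  have [->|/eqP p0] := eqVneq p 0; first by left.
  have [->|/eqP pnf] := eqVneq p f; first by right.
  by case: nex; exists p.
have drop q : q * q = q -> f * q = q -> q * f = q -> q <> f -> P q.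
  move=> qq fq qf qnf; apply: IHn => //.
  - by rewrite -fq mulrA ef.
  - by rewrite -qf -mulrA fe.
  rewrite -ltnS; apply: leq_trans le_f_n; rewrite ltnS ltnNge; apply/negP => le_fq.
  have sub : (fullv * <[q]> <= fullv * <[f]>)%VS.
    apply/subvP=> _ /memv_cosetP[u _ ->]; apply/memv_cosetP.
    by exists (u * q); rewrite ?memvf // -mulrA qf.
  have /eqP eqq : ((fullv * <[q]>)%VS == (fullv * <[f]>)%VS).
    by rewrite eqEdim sub.
  have : f \in (fullv * <[q]>)%VS.
    by rewrite eqq; apply/memv_cosetP; exists 1; rewrite ?memvf ?mul1r.
  case/memv_cosetP => u _ fu; apply: qnf.
  by rewrite -{1}fq {1}fu -mulrA qq -fu.
rewrite -(subrK p f); apply: PD; apply: drop => //.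
- by rewrite mulrBl !mulrBr ff fp pf pp subrr subr0.
- by rewrite mulrBr ff fp.
- by rewrite mulrBl ff pf.
- by rewrite -[RHS]subr0 => /addrI/oppr_inj.
Qed.

End Idempotents.

(** * The subalgebra generated by idempotents contains the commutator ideal *)

Section CommutatorIdeal.
Variables (F : fieldType) (A : falgType F).
Implicit Types (p q u v x y z : A).
Local Notation E := (idem_subalg A).
Local Notation I := (comm_ideal A).

Lemma comm_ideal_two_sided : two_sided_ideal I.
Proof.
split; first (apply/left_idealP; split).
- by move=> J [[Jl _] _]; exact: left_ideal0 Jl.
- move=> a x y Ix Iy J JP; have [[Jl _] _] := JP.
  by apply: left_idealD => //; [apply: left_idealM => //; apply: Ix | apply: Iy].
- by move=> x a Ix J JP; have [[_ Jr] _] := JP; exact: Jr (Ix _ JP).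
Qed.

Lemma comm_ideal_left : left_ideal I.
Proof. by case: comm_ideal_two_sided. Qed.

Lemma comm_idealMr x a : I x -> I (x * a).
Proof. by case: comm_ideal_two_sided => _; apply. Qed.

Lemma comm_ideal_commutator p x : p * p = p -> I (p * x - x * p).
Proof. by move=> pp; apply: sub_gen_smallest; exists p => //; exists x. Qed.

Lemma comm_ideal_min (J : set A) : two_sided_ideal J ->
  (forall p x, p * p = p -> J (p * x - x * p)) -> I `<=` J.
Proof. by move=> JP Jc; apply: smallest_sub => // _ [p pp [x ->]]; apply: Jc. Qed.

Lemma idempotentC p : p * p = p -> (1 - p) * (1 - p) = 1 - p.
Proof. by move=> pp; rewrite mulrBl mul1r mulrBr mulr1 pp subrr subr0. Qed.

(** The off-diagonal corners lie in the ideal because px(1-p) is its own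
commutator with p. *)
Lemma comm_ideal_corner p x : p * p = p -> I (p * x * (1 - p)).
Proof.
move=> pp; rewrite -mulrA.
suff -> : p * (x * (1 - p)) = p * (x * (1 - p)) - x * (1 - p) * p.
  exact: comm_ideal_commutator.
by rewrite -[x * _ * p]mulrA mulrBl mul1r pp subrr mulr0 subr0.
Qed.

Lemma comm_ideal_cornerC p x : p * p = p -> I ((1 - p) * x * p).
Proof.
by move=> pp; have := comm_ideal_corner x (idempotentC pp); rewrite subKr.
Qed.

Lemma idem_subalg1 : E 1.
Proof. by move=> B [[B1 _ _] _]; rewrite inE in B1. Qed.

Lemma idem_subalg_lin (k : F) x y : E x -> E y -> E (k *: x + y).
Proof.
move=> Ex Ey B BP; have [[_ Bl _] _] := BP.
by have := Bl k x y; rewrite !inE; apply; [apply: Ex | apply: Ey].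
Qed.

Lemma idem_subalgM x y : E x -> E y -> E (x * y).
Proof.
move=> Ex Ey B BP; have [[_ _ BM] _] := BP.
by have := BM x y; rewrite !inE; apply; [apply: Ex | apply: Ey].
Qed.

Lemma idem_subalgD x y : E x -> E y -> E (x + y).
Proof. by move=> Ex Ey; rewrite -[x]scale1r; apply: idem_subalg_lin. Qed.

Lemma idem_subalg0 : E 0.
Proof.
by rewrite -(addNr 1) -scaleN1r; apply: idem_subalg_lin idem_subalg1 idem_subalg1.
Qed.

Lemma idem_subalgZ (k : F) x : E x -> E (k *: x).
Proof. by move=> Ex; rewrite -[k *: x]addr0; apply: idem_subalg_lin idem_subalg0. Qed.

Lemma idem_subalgB x y : E x -> E y -> E (x - y).
Proof. by move=> Ex Ey; rewrite addrC -scaleN1r; apply: idem_subalg_lin. Qed.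

Lemma idem_subalg_idem p : p * p = p -> E p.
Proof. by move=> pp; apply: sub_gen_smallest. Qed.

Lemma idem_subalg_ind (P : A -> Prop) : P 1 ->
    (forall (k : F) x y, P x -> P y -> P (k *: x + y)) ->
    (forall x y, P x -> P y -> P (x * y)) ->
    (forall p, p * p = p -> P p) ->
  forall x, E x -> P x.
Proof.
move=> P1 Pl PM Pp; apply: (@smallest_sub _ _ _ P) => //.
split; first by rewrite inE.
- by move=> k x y; rewrite !inE; apply: Pl.
- by move=> x y; rewrite !inE; apply: PM.
Qed.

Lemma idempotent_addl p x : p * p = p -> p * x = x -> x * p = 0 ->
  (p + x) * (p + x) = p + x.
Proof.
move=> pp px xp; have xx : x * x = 0 by rewrite -{2}px mulrA xp mul0r.
by rewrite mulrDl !mulrDr pp px xp xx !addr0.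
Qed.

Lemma idempotent_addr p x : p * p = p -> p * x = 0 -> x * p = x ->
  (p + x) * (p + x) = p + x.
Proof.
move=> pp px xp; have xx : x * x = 0 by rewrite -{1}xp -mulrA px mulr0.
by rewrite mulrDl !mulrDr pp px xp xx !addr0.
Qed.

(** On generators [p,x] is the difference of the idempotents p + px(1-p) and
p + (1-p)xp; products follow from [uv,x] = [u,vx] + [v,xu]. *)
Lemma idem_subalg_lie u x : E u -> E (u * x - x * u).
Proof.
move=> Eu; move: u Eu x; apply: idem_subalg_ind => [x|k u v Pu Pv x|u v Pu Pv x|p pp x].
- by rewrite mul1r mulr1 subrr; apply: idem_subalg0.
- rewrite mulrDl mulrDr -scalerAl -scalerAr opprD addrACA -scalerBr.
  exact: idem_subalg_lin.
- suff -> : u * v * x - x * (u * v) =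
    (u * (v * x) - (v * x) * u) + (v * (x * u) - (x * u) * v).
    by apply: idem_subalgD.
  by rewrite !mulrA addrA subrK.
- suff -> : p * x - x * p = (p + p * x * (1 - p)) - (p + (1 - p) * x * p).
    apply: idem_subalgB; apply: idem_subalg_idem.
      apply: idempotent_addl => //; first by rewrite !mulrA pp.
      by rewrite -mulrA mulrBl mul1r pp subrr mulr0.
    apply: idempotent_addr => //; first by rewrite !mulrA mulrBr mulr1 pp subrr !mul0r.
    by rewrite -!mulrA pp.
  by rewrite opprD addrACA subrr add0r mulrBr mulr1 !mulrBl mul1r opprB addrA subrK.
Qed.

(** Because E is a Lie ideal, [u,v]x = [u,vx] - v[u,x] lies in E for u, v in E.
Applied to u = p and v = [p,[p,x]] this puts the right ideal generated by [p,x]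
in E, and one more commutator moves a left factor to the right. *)
Lemma comm_ideal_sub_idem_subalg : I `<=` E.
Proof.
have EE_ideal u v x : E u -> E v -> E ((u * v - v * u) * x).
  move=> Eu Ev.
  suff -> : (u * v - v * u) * x = (u * (v * x) - (v * x) * u) - v * (u * x - x * u).
    by apply: idem_subalgB; [|apply: idem_subalgM => //]; apply: idem_subalg_lie.
  by rewrite mulrBl mulrBr opprB !mulrA addrA subrK.
pose J : set A := [set a | forall x y, E (x * a * y)].
suff IJ : I `<=` J by move=> a /IJ/(_ 1 1); rewrite mul1r mulr1.
apply: comm_ideal_min => [|p x pp y z].
  split; last by move=> a b Ja x y; rewrite mulrA -mulrA; apply: Ja.
  apply/left_idealP; split=> [x y|a b c Jb Jc x y].
    by rewrite mulr0 mul0r; apply: idem_subalg0.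
  by rewrite mulrDr mulrDl mulrA; apply: idem_subalgD.
set c := p * x - x * p; have Ep := idem_subalg_idem pp.
(* c = [p,[p,c]], because pcp = 0 and pc + cp = c. *)
have Ecz w : E (c * w).
  have pcp : p * c * p = 0 by rewrite /c mulrBr mulrBl !mulrA pp -!mulrA pp subrr.
  have pc_cp : p * c + c * p = c.
    by rewrite /c mulrBr mulrBl !mulrA pp -!mulrA pp addrA subrK.
  move: c pcp pc_cp => c pcp pc_cp.
  rewrite (_ : c = p * (p * c - c * p) - (p * c - c * p) * p); last first.
    by rewrite mulrBr mulrBl !mulrA pp pcp -!mulrA pp subr0 sub0r opprK pc_cp.
  by apply: EE_ideal => //; apply: idem_subalg_lie.
have -> : y * c * z = c * (z * y) - (c * z * y - y * (c * z)).
  by rewrite opprB addrC !mulrA subrK.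
by apply: idem_subalgB => //; apply: idem_subalg_lie.
Qed.

End CommutatorIdeal.

(** * Zero action determined modules *)

Section ZeroActionDetermined.
Variables (F : fieldType) (A : falgType F).
Implicit Types (p a x y z : A).
Local Notation E := (idem_subalg A).
Local Notation I := (comm_ideal A).
Local Notation R := (jacobson A).

Lemma alg_scaleC (V : lmodType A) (k : F) a (v : V) :
  a *: (k%:A *: v) = k%:A *: (a *: v).
Proof. by rewrite !scalerA mulr_algl mulr_algr. Qed.

Section Flinear.
Variables (V : lmodType A) (g : V -> F).
Hypothesis gl : Flinear g.

Lemma FlinearD u v : g (u + v) = g u + g v.
Proof. by have := gl 1 u v; rewrite !scale1r mul1r. Qed.

Lemma Flinear0 : g 0 = 0.
Proof. by apply: (addrI (g 0)); rewrite -FlinearD !addr0. Qed.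

Lemma FlinearZ (k : F) u : g (k%:A *: u) = k * g u.
Proof. by have := gl k u 0; rewrite !addr0 Flinear0 addr0. Qed.

End Flinear.

(** The functional is determined by f, as Phi = f(1, -); so being zad is an
identity for f. *)
Lemma zad_eval (V : lmodType A) (f : A -> V -> F) : zad V -> Fbilinear f ->
    (forall a m, a *: m = 0 -> f a m = 0) ->
  forall x v, f x v = f 1 (x *: v).
Proof.
move=> zV fb f0 x v; have [Phi _ fPhi] := zV f fb f0.
by rewrite !fPhi scale1r.
Qed.

Lemma zad_quotient (V W : lmodType A) (g : {linear V -> W}) :
  (forall w, exists v, g v = w) -> zad V -> zad W.
Proof.
move=> surj zV f [fl fr] f0; exists (f 1) => // x w.
have [v <-] := surj w; rewrite -linearZ.
apply: (zad_eval (f := fun a u => f a (g u))) => //.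
- by split=> [u|a k u u']; rewrite ?linearP; [exact: fl | exact: fr].
- by move=> a u au0; apply: f0; rewrite -linearZ_LR au0 linear0.
Qed.

(** The products xp.(1-p)v and x(1-p).pv vanish, hence f is balanced over
idempotents, and balanced elements form a subalgebra. *)
Lemma zad_idem_subalg (V : lmodType A) (f : A -> V -> F) : Fbilinear f ->
    (forall a m, a *: m = 0 -> f a m = 0) ->
  forall u, E u -> forall x v, f (x * u) v = f x (u *: v).
Proof.
move=> [fl fr] f0.
have fDl x y v : f (x + y) v = f x v + f y v.
  by have := fl v 1 x y; rewrite !scale1r mul1r.
apply: idem_subalg_ind => [x v|k u w Pu Pw x v|u w Pu Pw x v|p pp x v].
- by rewrite mulr1 scale1r.
- have -> : (k *: u + w) *: v = k%:A *: (u *: v) + w *: v.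
    by rewrite scalerDl scalerA mulr_algl.
  by rewrite mulrDr -scalerAr (fl v k) fr Pu Pw.
- by rewrite mulrA Pw Pu scalerA.
- have e1 : f (x * p) ((1 - p) *: v) = 0.
    by apply: f0; rewrite scalerA -mulrA mulrBr mulr1 pp subrr mulr0 scale0r.
  have e2 : f (x * (1 - p)) (p *: v) = 0.
    by apply: f0; rewrite scalerA -mulrA mulrBl mul1r pp subrr mulr0 scale0r.
  rewrite -[v in LHS](subrK (p *: v)) -[v in v - _]scale1r -scalerBl.
  rewrite (FlinearD (fr _)) e1 add0r.
  by rewrite -[x in RHS]mulr1 -(subrK p 1) mulrDr fDl e2 add0r.
Qed.

(** Modulo the commutator ideal I, the vector v = pv generates no more than its
scalar multiples.  Take alpha vanishing on the non-units of pAp with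
alpha(p) = 1, and test the zad property on f(a,u) = alpha(pap) rho(pu).  If
au = 0 and pap is a unit, then pu is in IV because pa(1-p) is in I.  The identity
f(x,v) = f(1,xv) then reads alpha(pxp) rho(v) = rho(pxv). *)
Lemma zad_primitive_functional (V : lmodType A) p v (rho : V -> F) :
    zad V -> primitive p -> p *: v = v -> Flinear rho ->
    (forall i u, I i -> rho (i *: u) = 0) -> rho v = 0 ->
  forall x, rho (x *: v) = 0.
Proof.
move=> zV prim pv rl rI rv x; have [pp p0 _] := prim.
(* A left ideal maximal among those avoiding p contains all non-units. *)
have [|M [Ml nMp _ maxM]] := max_left_ideal (Q := fun J => ~ J p) (left_ideal_zero A).
  by move=> /= p00.
have Mp b : b * p = b -> ~ (exists z, z * b = p) -> M b.
  move=> bp nz; apply: contrapT => nMb; apply: nMb.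
  rewrite -(maxM _ (add_principal_left_ideal b Ml)); first exact: mem_add_principal.
    by case=> a Mpab; apply/nMp/(primitive_absorb prim Ml bp Mpab).
  exact: sub_add_principal.
have [al [alM alp]] := separating_functional (left_ideal_subspace Ml) nMp.
pose f a u := al (p * a * p) * rho (p *: u).
have fb : Fbilinear f.
  split=> [u k a b|a k u u']; rewrite /f.
    by rewrite mulrDr mulrDl -scalerAr -scalerAl linearP /= mulrDl mulrA.
  by rewrite scalerDr alg_scaleC (FlinearD rl) (FlinearZ rl) mulrDr mulrCA.
have f0 a u : a *: u = 0 -> f a u = 0.
  move=> au0; rewrite /f.
  have [[z zb]|nz] := pselect (exists z, z * (p * a * p) = p); last first.
    by rewrite alM ?mul0r //; apply: Mp => //; rewrite -mulrA pp.
  suff -> : p *: u = - (z * (p * a * (1 - p))) *: u.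
    rewrite rI ?mulr0 //; apply: left_idealN (comm_ideal_left A) _.
    by apply: left_idealM (comm_ideal_left A) _; apply: comm_ideal_corner.
  by rewrite !mulrBr mulr1 zb opprB scalerBl mulrA -scalerA au0 scaler0 subr0.
have := zad_eval zV fb f0 x v; rewrite /f pv rv mulr0 mulr1 pp alp mul1r => /esym rpx.
have -> : x *: v = p *: (x *: v) + ((1 - p) * x * p) *: v.
  by rewrite -!scalerA pv scalerBl scale1r addrC subrK.
by rewrite (FlinearD rl) rpx add0r rI //; apply: comm_ideal_cornerC.
Qed.

Variable e : A.

Fact gen_subproof a : (a * e : A^o) \in Submodule (principal_closed e).
Proof. by rewrite inE; exists a. Qed.

Definition gen a : Ae e :=
  @SubMod _ A^o (Submodule (principal_closed e)) (a * e) (gen_subproof a).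

Lemma Ae_valZ a (u : Ae e) : sub_mod_val (a *: u) = a * sub_mod_val u.
Proof. by []. Qed.

Lemma Ae_valD (u v : Ae e) : sub_mod_val (u + v) = sub_mod_val u + sub_mod_val v.
Proof. by []. Qed.

Lemma Ae_val0 : sub_mod_val (0 : Ae e) = 0.
Proof. by []. Qed.

Lemma gen_valK a : sub_mod_val (gen a) = a * e.
Proof. by []. Qed.

Lemma Ae_inj (u v : Ae e) : sub_mod_val u = sub_mod_val v -> u = v.
Proof. exact: val_inj. Qed.

Lemma Ae_valP (u : Ae e) : exists a, sub_mod_val u = a * e.
Proof. by case: u => u /=; rewrite inE => -[a _ <-]; exists a. Qed.

(** The preceding lemma dualised: a functional separating ap from
Fp + I + ker g would descend to V and contradict it. *)
Lemma zad_primitive_corner (V : lmodType A) (g : {linear Ae e -> V}) p :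
    (forall w, exists u, g u = w) -> zad V -> primitive p ->
    e * p = p -> p * e = p ->
  forall a, exists c i k,
    [/\ I i, g k = 0 & a * p = c *: p + i + sub_mod_val k].
Proof.
move=> surj zV prim ep pe a; have [pp _ _] := prim.
pose K : set A := [set x | exists c i k,
  [/\ I i, g k = 0 & x = c *: p + i + sub_mod_val k]].
have Ks : subspace_set K.
  split=> [|k x y [c [i [u [Ii gu ->]]]] [d [j [w [Ij gw ->]]]]].
    exists 0, 0, 0; rewrite linear0 Ae_val0 scale0r !addr0.
    by split=> //; apply: left_ideal0 (comm_ideal_left A).
  exists (k * c + d), (k *: i + j), (k%:A *: u + w); split.
  - apply: left_idealD (comm_ideal_left A) _ Ij.
    exact: left_idealZ (comm_ideal_left A) Ii.
  - by rewrite linearP /= gu gw scaler0 addr0.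
  - rewrite Ae_valD Ae_valZ mulr_algl !scalerDr scalerDl scalerA.
    by rewrite addrACA [in RHS](addrACA (_ *: p)).
apply: contrapT => nK; have [l [lK lap]] := separating_functional Ks nK.
have lker u : g u = 0 -> l (sub_mod_val u) = 0.
  move=> gu; apply: lK; exists 0, 0, u; split=> //.
    exact: left_ideal0 (comm_ideal_left A).
  by rewrite scale0r !add0r.
have lI i : I i -> l i = 0.
  move=> Ii; apply: lK; exists 0, i, 0; split=> //; first exact: linear0.
  by rewrite scale0r add0r Ae_val0 addr0.
have lp : l p = 0.
  apply: lK; exists 1, 0, 0; split; last by rewrite scale1r Ae_val0 !addr0.
    exact: left_ideal0 (comm_ideal_left A).
  exact: linear0.
pose rho w := l (sub_mod_val (sval (cid (surj w)))).
have rhoE u : rho (g u) = l (sub_mod_val u).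
  rewrite /rho; case: cid => u' /= gu'; apply/eqP; rewrite -subr_eq0 -linearB /=.
  by apply/eqP; apply: (lker (u' - u)); rewrite linearB /= gu' subrr.
case/negP: (oner_neq0 F); apply/eqP; rewrite -lap -[p]pe.
rewrite -[p * e]/(sub_mod_val (gen p)) -Ae_valZ -rhoE linearZ /=.
apply: (zad_primitive_functional zV prim).
- by rewrite -linearZ; congr (g _); apply: Ae_inj; rewrite Ae_valZ gen_valK mulrA pp.
- move=> k v w; have [v' <-] := surj v; have [w' <-] := surj w.
  by rewrite -linearP !rhoE Ae_valD Ae_valZ mulr_algl linearP.
- move=> i v Ii; have [v' <-] := surj v; rewrite -linearZ rhoE Ae_valZ.
  by apply: lI; apply: comm_idealMr.
- by rewrite rhoE gen_valK pe.
Qed.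

Lemma zad_of_generated : e * e = e -> rtrans setT e = rtrans E e -> zad (Ae e).
Proof.
move=> ee eqAE f fb f0; have [fl fr] := fb.
exists (fun u : Ae e => f (sub_mod_val u) (gen e)).
  by move=> k u v; rewrite Ae_valD Ae_valZ mulr_algl (fl _ k).
move=> x v; have [a va] := Ae_valP v.
have [u Eu uv] : rtrans E e (sub_mod_val v) by rewrite -eqAE; exists a.
have -> : v = u *: gen e by apply: Ae_inj; rewrite Ae_valZ gen_valK ee.
rewrite -(zad_idem_subalg fb f0 Eu) !Ae_valZ gen_valK ee mulrA.
rewrite (zad_idem_subalg fb f0 (idem_subalg_idem ee)).
by congr (f _ _); apply: Ae_inj; rewrite Ae_valZ gen_valK mulrA ee.
Qed.

(** At a primitive p, write rp = cp + i with i in I.  If c is nonzero then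
(1 - r/c)p is in I, so quasi-regularity puts p itself in I. *)
Lemma zad_radical_sub : e * e = e -> zad (Ae e) -> rtrans R e `<=` rtrans I e.
Proof.
move=> ee zV; have Il := comm_ideal_left A.
suff IR r : R r -> I (r * e).
  by move=> _ [r Rr <-]; exists (r * e); [exact: IR | rewrite -mulrA ee].
move=> Rr; apply: (@idempotent_induction _ _ (fun p => I (r * p)) _ ee).
- by rewrite mulr0; exact: left_ideal0 Il.
- by move=> p q Ip Iq; rewrite mulrDr; exact: left_idealD Il Ip Iq.
move=> p prim ep pe.
have surj (w : Ae e) : exists u, (idfun : {linear Ae e -> Ae e}) u = w by exists w.
have [c [i [k [Ii /= -> rp]]]] := zad_primitive_corner surj zV prim ep pe r.
rewrite Ae_val0 addr0 in rp; have [c0|c0] := eqVneq c 0.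
  by rewrite rp c0 scale0r add0r.
apply: (left_idealM _ Il); apply: (left_ideal_quasi_regular (r := c^-1 *: r) Il).
  exact: left_idealZ (jacobson_left_ideal A) Rr.
rewrite -scalerAl rp scalerDr scalerA mulVf // scale1r opprD addNKr.
by apply: (left_idealN Il); apply: (left_idealZ _ Il).
Qed.

End ZeroActionDetermined.

(** * Self-extensions of one-dimensional modules *)

Section SelfExt.
Variables (F : fieldType) (A : falgType F) (S : lmodType A) (s : S).
Implicit Types (p a : A).
Local Notation I := (comm_ideal A).
Local Notation R := (jacobson A).
Hypotheses (s0 : s != 0) (sS : forall v : S, exists k : F, v = k%:A *: s).

Lemma line_scale_inj (k k' : F) : k%:A *: s = k'%:A *: s :> S -> k = k'.
Proof.
move=> /eqP; rewrite -subr_eq0 -scalerBl -scalerBl => /eqP kk.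
apply/eqP; rewrite -subr_eq0; apply: contraNT s0 => nk; apply/eqP.
rewrite -[s]scale1r -(scale1r (1 : A)) -(mulVf nk) -scalerA -mulr_algl -scalerA.
by rewrite kk scaler0.
Qed.

Lemma line_annihilator a : a *: s = 0 -> forall v : S, a *: v = 0.
Proof. by move=> as0 v; have [k ->] := sS v; rewrite alg_scaleC as0 scaler0. Qed.

Lemma line_idempotent p : p * p = p -> p *: s = 0 \/ (1 - p) *: s = 0.
Proof.
move=> pp; have [k pk] := sS (p *: s).
have /line_scale_inj kk : k%:A *: s = (k * k)%:A *: s.
  by rewrite -pk -{1}pp -scalerA pk alg_scaleC pk scalerA mulr_algl scalerA.
have /eqP : k * (1 - k) = 0 by rewrite mulrBr mulr1 -kk subrr.
rewrite mulf_eq0 subr_eq0 => /orP[/eqP k0|/eqP k1].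
  by left; rewrite pk k0 !scale0r.
by right; rewrite scalerBl scale1r pk -k1 !scale1r subrr.
Qed.

(** A sum of primitive idempotents acting by 0 would act by 0, but 1 does not. *)
Lemma line_primitive : exists2 p, primitive p & (1 - p) *: s = 0.
Proof.
apply: contrapT => nex; case/eqP: s0; rewrite -[s]scale1r.
apply: (@idempotent_induction _ A (fun p => p *: s = 0)) => [||p q ps qs|p prim _ _].
- by rewrite mulr1.
- by rewrite scale0r.
- by rewrite scalerDl ps qs addr0.
- have [pp _ _] := prim; have [//|p1] := line_idempotent pp.
  by case: nex; exists p.
Qed.

(** If a kills the line, pap acts by 0 while p acts by 1; so no multiple of pap
is p, and pap is a non-unit of the local corner.  A maximal left ideal not
containing pap would by absorption contain p, hence pap. *)
Lemma primitive_corner_radical p a : primitive p -> (1 - p) *: s = 0 ->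
  a *: s = 0 -> R (p * a * p).
Proof.
move=> prim p1 as0; have [pp _ _] := prim.
have ps : p *: s = s by apply/esym/eqP; rewrite -subr_eq0 -{1}[s]scale1r -scalerBl p1.
have bp : p * a * p * p = p * a * p by rewrite -mulrA pp.
apply: mem_jacobson => M c [Ml _ _] Mc.
rewrite -bp; apply: (left_idealM _ Ml).
apply: (primitive_absorb prim Ml bp (a := p * c)).
  by rewrite -mulrA -[X in X - _]mulr1 -mulrBr; apply: left_idealM.
case=> z zb; case/eqP: s0; rewrite -ps -zb -!scalerA ps as0.
by rewrite !scaler0.
Qed.

Section Resolution.
Variables (P : nat -> lmodType A) (d : forall i, {linear P i.+1 -> P i}).
Variables (eps : {linear P 0%N -> S}) (g : {linear P 1%N -> S}).
Hypothesis surj : forall m, exists x, eps x = m.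
Hypothesis ex0 : forall x, eps x = 0 <-> exists q, d 0%N q = x.
Hypothesis ex1 : forall x, d 0%N x = 0 <-> exists q, d 1%N q = x.
Hypothesis gd : forall q, g (d 1%N q) = 0.

(** With K the image of d 0, this is the kernel of the map K -> S induced by g.
The quotient of P 0 by it is the self-extension of S defined by the cocycle g;
working inside P 0 avoids forming that quotient. *)
Definition cocycle_kernel (x : P 0%N) : Prop := exists2 y, d 0%N y = x & g y = 0.
Local Notation L := cocycle_kernel.

Lemma cocycle_unique y y' : d 0%N y = d 0%N y' -> g y = g y'.
Proof.
move=> yy'; have /ex1[q qy] : d 0%N (y - y') = 0 by rewrite linearB /= yy' subrr.
by apply/eqP; rewrite -subr_eq0 -linearB -qy gd.
Qed.

Lemma cocycle_kernel_lin a x y : L x -> L y -> L (a *: x + y).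
Proof.
move=> [u <- gu] [v <- gv]; exists (a *: u + v); rewrite linearP //= gu gv.
by rewrite scaler0 addr0.
Qed.

Lemma cocycle_kernel0 : L 0.
Proof. by exists 0; rewrite linear0. Qed.

Definition cocycle_ann : set A := [set a | forall x, L (a *: x)].
Local Notation Ann := cocycle_ann.

(** As L is a submodule, the elements sending P 0 into L form the annihilator of
the self-extension. *)
Lemma cocycle_ann_two_sided : two_sided_ideal Ann.
Proof.
split; last by move=> a b Aa x; rewrite -scalerA; apply: Aa.
apply/left_idealP; split=> [x|a b c Ab Ac x].
  by rewrite scale0r; apply: cocycle_kernel0.
by rewrite scalerDl -scalerA; apply: cocycle_kernel_lin.
Qed.

(** If p kills S then pP 0 lies in K, and applying p once more lands in the part
of K on which the map to S vanishes. *)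
Lemma cocycle_ann_idempotent p : p * p = p -> p *: s = 0 -> Ann p.
Proof.
move=> pp ps x.
have /ex0[y dy] : eps (p *: x) = 0 by rewrite linearZ /= line_annihilator.
exists (p *: y); rewrite linearZ /= ?dy ?scalerA ?pp //.
exact: line_annihilator.
Qed.

(** An idempotent kills S or its complement does, and both have the same
commutators up to sign. *)
Lemma cocycle_ann_comm_ideal : I `<=` Ann.
Proof.
have [Al Ar] := cocycle_ann_two_sided.
apply: comm_ideal_min => // p x pp.
have [ps|ps] := line_idempotent pp.
  have Ap := cocycle_ann_idempotent pp ps.
  by apply: (left_idealB Al); [apply: Ar | apply: (left_idealM _ Al)].
have Ap := cocycle_ann_idempotent (idempotentC pp) ps.
have -> : p * x - x * p = x * (1 - p) - (1 - p) * x.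
  by rewrite mulrBr mulr1 mulrBl mul1r opprB [RHS]addrC subrKA.
by apply: (left_idealB Al); [apply: (left_idealM _ Al) | apply: Ar].
Qed.

Variable e : A.
Hypotheses (ee : e * e = e) (es : e *: s = s).
Hypothesis Re_Ie : rtrans R e `<=` rtrans I e.

(** The self-extension is killed by 1 - e and by I, hence by r = re + r(1-e)
for r in R.  The Peirce decomposition of a at a primitive p acting by 1 on S
then reduces to the corner pap, which is in R. *)
Lemma cocycle_ann_character a : a *: s = 0 -> Ann a.
Proof.
move=> as0; have [Al Ar] := cocycle_ann_two_sided.
have Ae1 : Ann (1 - e).
  apply: cocycle_ann_idempotent (idempotentC ee) _.
  by rewrite scalerBl scale1r es subrr.
have AR r : R r -> Ann r.
  move=> Rr; have [i Ii ie] : rtrans I e (r * e) by apply: Re_Ie; exists r.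
  have -> : r = i * e + r * (1 - e) by rewrite ie mulrBr mulr1 addrC subrK.
  apply: (left_idealD Al); last exact: (left_idealM _ Al).
  by apply: cocycle_ann_comm_ideal; apply: comm_idealMr.
have [p prim p1] := line_primitive; have [pp _ _] := prim.
have Ap := cocycle_ann_idempotent (idempotentC pp) p1.
have -> : a = a * (1 - p) + ((1 - p) * (a * p) + p * a * p).
  by rewrite !mulrBl mul1r mulrA subrK mulrBr mulr1 subrK.
apply: (left_idealD Al); first exact: (left_idealM _ Al).
apply: (left_idealD Al); first exact: Ar.
exact: AR (primitive_corner_radical prim p1 as0).
Qed.

(** Now P 0 is K plus the line of a lift p0 of s, modulo L the algebra acts by
scalars, and so extending g by 0 on p0 is A-linear. *)
Lemma cocycle_extends : exists h : {linear P 0%N -> S}, forall y, g y = h (d 0%N y).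
Proof.
have [p0 ep0] := surj s.
have /choice[h hP] : forall x, exists m, forall c y,
    eps x = c%:A *: s -> d 0%N y = x - c%:A *: p0 -> m = g y.
  move=> x; have [c ec] := sS (eps x).
  have /ex0[y dy] : eps (x - c%:A *: p0) = 0.
    by rewrite linearB linearZ /= ep0 ec subrr.
  exists (g y) => c' y'; rewrite ec => /line_scale_inj <- dy'.
  by apply: cocycle_unique; rewrite dy dy'.
have hl : linear h.
  move=> a x x'.
  have [c ec] := sS (eps x); have [c' ec'] := sS (eps x').
  have [k ak] := sS (a *: s).
  have /ex0[y dy] : eps (x - c%:A *: p0) = 0.
    by rewrite linearB linearZ /= ep0 ec subrr.
  have /ex0[y' dy'] : eps (x' - c'%:A *: p0) = 0.
    by rewrite linearB linearZ /= ep0 ec' subrr.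
  have Aak : Ann (a - k%:A).
    by apply: cocycle_ann_character; rewrite scalerBl ak subrr.
  have [z dz gz] := Aak (c%:A *: p0).
  rewrite (hP x c y) // (hP x' c' y') // (hP _ (k * c + c') (a *: y + y' + z)).
  - by rewrite linearD linearP /= gz addr0.
  - rewrite linearP /= ec ec' alg_scaleC ak scalerA mulr_algl scalerA.
    by rewrite mulrC -scalerDl -scalerDl.
  - rewrite linearD linearP /= dy dy' dz scalerBr scalerBl.
    have -> : (k * c + c')%:A *: p0 = k%:A *: (c%:A *: p0) + c'%:A *: p0.
      by rewrite scalerA mulr_algl scalerA -scalerDl -scalerDl.
    rewrite opprD [X in X + _ = _]addrACA -[LHS]addrA; congr (_ + _).
    by rewrite addrC addrACA subrr add0r.
pose hL := GRing.isLinear.Build A (P 0%N) S *:%R h hl.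
pose hh : {linear P 0%N -> S} := HB.pack h hL.
exists hh => y; apply/esym/(hP _ 0); last by rewrite !scale0r subr0.
by rewrite !scale0r; apply/ex0; exists y.
Qed.

End Resolution.

Lemma line_Ext1_eq0 e : e * e = e -> e *: s = s ->
  rtrans R e `<=` rtrans I e -> Ext1_eq0 S S.
Proof.
move=> ee es ReIe P d eps [_ surj ex0 ex] g gd.
exact: (cocycle_extends surj ex0 (ex 0%N) gd ee es ReIe).
Qed.

End SelfExt.

(** The image of e generates the quotient and is fixed by e, so e cannot kill
it. *)
Lemma quotient_Ext1_eq0 (F : fieldType) (A : falgType F) (e : A)
    (N : submodule (Ae e)) : e * e = e ->
  rtrans (jacobson A) e `<=` rtrans (comm_ideal A) e ->
  one_dimensional (quot_mod N) -> Ext1_eq0 (quot_mod N) (quot_mod N).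
Proof.
move=> ee ReIe [s s0 sS].
apply: (line_Ext1_eq0 s0 sS ee) => //.
have [se|se] := line_idempotent s0 sS ee; last first.
  by apply/esym/eqP; rewrite -subr_eq0 -{1}[s]scale1r -scalerBl se.
pose t : quot_mod N := quot_pi N (gen e 1).
have t0 : t = 0.
  rewrite -(line_annihilator sS se t) -linearZ; congr (quot_pi N _); apply: Ae_inj.
  by rewrite Ae_valZ gen_valK mul1r ee.
case/eqP: s0; elim/quot_piP: s sS se => v _ _; have [a va] := Ae_valP v.
have -> : v = a *: gen e 1 by apply: Ae_inj; rewrite Ae_valZ gen_valK mul1r.
by rewrite linearZ /= -/t t0 scaler0.
Qed.

(** * Free resolutions *)

Section FreeModules.
Variable A : nzRingType.

Definition free_mod n : lmodType A := {ffun 'I_n -> A^o}.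

Definition basis_vector n (i : 'I_n) : free_mod n := [ffun j => (i == j)%:R].

Lemma free_mod_decomp n (c : free_mod n) : c = \sum_i (c i : A) *: basis_vector i.
Proof.
apply/ffunP=> j; rewrite sum_ffunE (bigD1 j) //= big1 => [|i ij].
  by rewrite !ffunE eqxx addr0 /GRing.scale /= mulr1.
by rewrite !ffunE (negPf ij) /GRing.scale /= mulr0.
Qed.

Section Combination.
Variables (M : lmodType A) (n : nat) (b : 'I_n -> M).

Definition comb (c : free_mod n) : M := \sum_i (c i : A) *: b i.

Fact comb_linear : linear comb.
Proof.
move=> a u v; rewrite /comb scaler_sumr -big_split; apply: eq_bigr => i _ /=.
by rewrite !ffunE scalerDl scalerA.
Qed.
HB.instance Definition _ := GRing.isLinear.Build A (free_mod n) M _ comb comb_linear.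

End Combination.

Lemma free_mod_projective n : projective (free_mod n).
Proof.
move=> M N g f surj.
have /choice[b gb] : forall i : 'I_n, exists x, g x = f (basis_vector i).
  by move=> i; apply: surj.
exists (comb b) => c; rewrite [c in RHS]free_mod_decomp /= /comb !linear_sum.
by apply: eq_bigr => i _; rewrite !linearZ /= gb.
Qed.

End FreeModules.

Section Resolutions.
Variables (F : fieldType) (A : falgType F).

(** An F-basis of the submodule generates it. *)
Lemma submodule_finitely_generated n (K : submodule (free_mod A n)) :
  exists k (d : {linear free_mod A k -> free_mod A n}),
    forall x, x \in K <-> exists q, d q = x.
Proof.
have [K0 Kl] := submoduleP K.
pose V : vectType F := {ffun 'I_n -> A}.
have Ks : subspace_set [set x : V | (x : free_mod A n) \in K].
  split=> //= k u v Ku Kv.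
  have -> : k *: u + v = (k%:A : A) *: (u : free_mod A n) + v :> V.
    by apply/ffunP => i; rewrite !ffunE /GRing.scale /= mulr_algl.
  exact: Kl.
have [U UK] := subspace_vspace Ks.
pose b (i : 'I_(\dim U)) : free_mod A n := (vbasis U)`_i.
have bU i : b i \in K by apply/UK/vbasis_mem/mem_nth; rewrite size_tuple.
exists (\dim U), (comb b) => x; split=> [/UK Ux|[q <-]]; last first.
  by apply: rpred_sum => i _; apply: rpredZ.
exists [ffun i => (coord (vbasis U) i (x : V))%:A]; rewrite /= /comb.
rewrite [x in RHS](coord_vbasis Ux); apply: eq_bigr => i _; rewrite ffunE.
by apply/ffunP=> j; rewrite !ffunE /GRing.scale /= mulr_algl.
Qed.

Lemma kernel_submod_closed (M N : lmodType A) (f : {linear M -> N}) :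
  submod_closed [pred x | f x == 0].
Proof.
split=> [|a u v]; rewrite !inE ?linear0 // => /eqP fu /eqP fv.
by rewrite linearP fu fv scaler0 addr0.
Qed.

Definition kernel (M N : lmodType A) (f : {linear M -> N}) : submodule M :=
  Submodule (kernel_submod_closed f).

(** A free module together with the submodule that the next map has to cover. *)
Definition stage := {n : nat & submodule (free_mod A n)}.

Definition cover_rank (s : stage) : nat :=
  sval (cid (submodule_finitely_generated (tagged s))).

Definition cover (s : stage) :
    {linear free_mod A (cover_rank s) -> free_mod A (tag s)} :=
  sval (cid (svalP (cid (submodule_finitely_generated (tagged s))))).

Lemma coverP (s : stage) x : x \in tagged s <-> exists q, cover s q = x.
Proof. exact: svalP (cid (svalP (cid (submodule_finitely_generated (tagged s))))) x. Qed.

Definition next_stage (s : stage) : stage := Tagged _ (kernel (cover s)).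

Definition syzygy (s : stage) i : stage := iter i next_stage s.

Lemma syzygy_resolution (M : lmodType A) n (eps : {linear free_mod A n -> M}) :
    (forall m, exists x, eps x = m) ->
  let s := Tagged _ (kernel eps) : stage in
  projective_resolution (P := fun i => free_mod A (tag (syzygy s i)))
    (fun i => cover (syzygy s i)) eps.
Proof.
move=> surj s; split=> //.
- by move=> i; apply: free_mod_projective.
- by move=> x; rewrite -(@coverP s) inE; split=> /eqP.
- by move=> i x; rewrite -(@coverP (syzygy s i.+1)) inE; split=> /eqP.
Qed.

(** Extending the presentation A -> M to a free resolution turns a homomorphism
g from the annihilator of s into a cocycle; being a coboundary means that g
extends to A, where homomorphisms are right multiplications a |-> a t. *)
Lemma cyclic_Ext1_extension (M N : lmodType A) (s : M) (g : A -> N) :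
    Ext1_eq0 M N -> (forall m, exists a, m = a *: s) ->
    (forall a x y, x *: s = 0 -> y *: s = 0 -> g (a * x + y) = a *: g x + g y) ->
  exists t : N, forall a, a *: s = 0 -> g a = a *: t.
Proof.
move=> ext gens gl.
pose eps : {linear free_mod A 1 -> M} := comb (fun _ : 'I_1 => s).
have epsE c : eps c = (c ord0 : A) *: s by rewrite /= /comb big_ord1.
have surj m : exists x, eps x = m.
  by have [a ->] := gens m; exists [ffun=> a]; rewrite epsE ffunE.
have res := syzygy_resolution surj.
set st := (Tagged _ (kernel eps) : stage) in res.
pose d0 := cover st.
have d0s q : (d0 q ord0 : A) *: s = 0.
  rewrite -epsE; apply/eqP; have : d0 q \in tagged st by apply/coverP; exists q.
  by rewrite inE.
pose g1 q := g (d0 q ord0).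
have g1l : linear g1 by move=> a q q'; rewrite /g1 linearP !ffunE gl.
pose g1L := GRing.isLinear.Build A _ N *:%R g1 g1l.
pose gg : {linear free_mod A (cover_rank st) -> N} := HB.pack g1 g1L.
have [|h hP] := ext _ _ _ res gg.
  have g0 : g 0 = 0.
    apply: (addrI (g 0)); have := gl 1 0 0 (scale0r s) (scale0r s).
    by rewrite mulr0 !addr0 scale1r.
  have [_ _ _ ex] := res => q; rewrite /= /g1 (_ : d0 _ = 0) ?ffunE //.
  by apply/(ex 0%N); exists q.
exists (h [ffun=> 1]) => a as0.
have /coverP[q qa] : ([ffun=> a] : free_mod A 1) \in tagged st.
  by rewrite inE epsE ffunE as0.
have := hP q; rewrite -/d0 [d0 q]qa /= /g1 [d0 q]qa ffunE => ->.
rewrite -linearZ; congr (h _).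
by apply/ffunP=> i; rewrite !ffunE /GRing.scale /= mulr1.
Qed.

End Resolutions.

(** * Vanishing self-extensions and generation by idempotents *)

Section Generation.
Variables (F : fieldType) (A : falgType F) (e p : A).
Local Notation E := (idem_subalg A).
Local Notation I := (comm_ideal A).
Local Notation R := (jacobson A).
Hypotheses (pp : p * p = p) (pe : p * e = p).

(** The left ideal I + Rp; modulo I it is the image of the radical
pRp of the corner pAp. *)
Definition corner_radical : set A :=
  [set x | exists i r, [/\ I i, R r & x = i + r * p]].
Local Notation W := corner_radical.

Lemma corner_radical_left : left_ideal W.
Proof.
have Il := comm_ideal_left A; have Rl := jacobson_left_ideal A.
apply/left_idealP; split=> [|a x y [i [r [Ii Rr ->]]] [j [q [Ij Rq ->]]]].
  by exists 0, 0; rewrite mul0r addr0; split=> //; exact: left_ideal0.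
exists (a * i + j), (a * r + q); split.
- by apply: (left_idealD Il) => //; apply: (left_idealM _ Il).
- by apply: (left_idealD Rl) => //; apply: (left_idealM _ Rl).
- by rewrite mulrDr mulrDl -mulrA addrACA.
Qed.

Definition corner_radical_pred : {pred Ae e} :=
  [pred u : Ae e | `[< W (sub_mod_val u * p) >]].

Fact corner_radical_closed : submod_closed corner_radical_pred.
Proof.
have Wl := corner_radical_left.
split=> [|a u v]; rewrite !inE /=.
  by rewrite mul0r; exact: left_ideal0 Wl.
rewrite mulrDl -mulrA => Wu Wv.
by apply: (left_idealD Wl) => //; apply: (left_idealM _ Wl).
Qed.

Let N := Submodule corner_radical_closed.
Let s : quot_mod N := quot_pi N (gen e p).

Lemma corner_radical_quotient0 (u : Ae e) :
  quot_pi N u = 0 <-> W (sub_mod_val u * p).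
Proof.
have -> : (quot_pi N u = 0) <-> (u \in N).
  rewrite -[u in u \in N]subr0 -quot_piE (_ : quot_pi N 0 = 0) ?linear0 //.
  by split=> [->|/eqP].
by split=> /asboolP.
Qed.

Lemma corner_radical_ann a : a *: s = 0 <-> W (a * p).
Proof.
by rewrite -linearZ corner_radical_quotient0 Ae_valZ gen_valK pe -mulrA pp.
Qed.

Hypothesis nIp : ~ I p.
Hypothesis top : forall a, exists c : F, W ((a - c%:A) * p).

(** If p = i + rp then (1 - r)p is in I. *)
Lemma corner_radical_proper : ~ W p.
Proof.
move=> [i [r [Ii Rr pir]]]; apply: nIp.
apply: (left_ideal_quasi_regular (comm_ideal_left A) Rr).
by rewrite {1}pir addrK.
Qed.

Lemma corner_quotient_neq0 : s != 0.
Proof.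
apply/eqP=> s0; apply: corner_radical_proper.
by rewrite -[p]mul1r -corner_radical_ann s0 scaler0.
Qed.

Lemma corner_quotient_line v : exists k : F, v = k%:A *: s.
Proof.
elim/quot_piP: v => u; have [c Wc] := top (sub_mod_val u); exists c.
apply/eqP; rewrite -subr_eq0 -linearZ -linearB; apply/eqP/corner_radical_quotient0.
have -> : sub_mod_val (u - c%:A *: gen e p) = sub_mod_val u - c%:A * (p * e) by [].
by rewrite pe mulrBl -mulrA pp -mulrBl.
Qed.

(** Let K be the annihilator of the line S = Ae/N, and T the ideal of all x with
xp in I; the quotient A/T is the corner pAp modulo I.  If Nakayama failed to
give K = T, some functional l would vanish on KK but not on K, and x |-> l(x)s
would be a homomorphism K -> S.  It extends to A since Ext^1(S,S) = 0, but every
homomorphism A -> S vanishes on K. *)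
Lemma corner_generated :
  (forall N' : submodule (Ae e),
     one_dimensional (quot_mod N') -> Ext1_eq0 (quot_mod N') (quot_mod N')) ->
  forall a, E (a * p).
Proof.
move=> ext a; have Il := comm_ideal_left A; have Wl := corner_radical_left.
pose T : set A := [set x | I (x * p)]; pose K : set A := [set x | W (x * p)].
have preim (J : set A) : left_ideal J -> left_ideal [set x | J (x * p)].
  move=> Jl; apply/left_idealP; split=> [|b x y Jx Jy] /=.
    by rewrite mul0r; apply: left_ideal0.
  by rewrite mulrDl -mulrA; apply: (left_idealD Jl) => //; apply: (left_idealM _ Jl).
have Tl : left_ideal T := preim _ Il; have Kl : left_ideal K := preim _ Wl.
(* T is a two-sided ideal because (1 - p)yp is in I. *)
have Tr x y : T x -> T (x * y).
  move=> Tx; rewrite /T /= (_ : _ * p = x * ((1 - p) * y * p) + x * p * (y * p)).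
    apply: (left_idealD Il); last exact: comm_idealMr.
    by apply: (left_idealM _ Il); apply: comm_ideal_cornerC.
  by rewrite !mulrBl mul1r mulrBr !mulrA subrK.
have TK : T `<=` K.
  move=> x Tx; exists (x * p), 0; rewrite mul0r addr0; split=> //.
  exact: left_ideal0 (jacobson_left_ideal A).
suff KT : K `<=` T.
  have [c /KT Tc] := top a; rewrite -(subrK (c *: p) (a * p)).
  apply: idem_subalgD; last exact: idem_subalgZ (idem_subalg_idem pp).
  by apply: comm_ideal_sub_idem_subalg; rewrite -mulr_algl -mulrBl.
apply: nakayama => // J Jl TJ RKJ x Kx; apply: contrapT => nJx.
have [l [lJ lx]] := separating_functional (left_ideal_subspace Jl) nJx.
(* K = T + R: if yp = i + rp then (y - r)p is in I. *)
have KKJ y z : K y -> K z -> J (y * z).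
  move=> [i [r [Ii Rr yir]]] Kz; rewrite -(subrK r y) mulrDl.
  apply: (left_idealD Jl); last exact: RKJ.
  apply: TJ; apply: Tr.
  by rewrite /T /= mulrBl yir addrK.
have s0 := corner_quotient_neq0; have sS := corner_quotient_line.
have ext_s : Ext1_eq0 (quot_mod N) (quot_mod N) by apply: ext; exists s.
have gens m : exists b, m = b *: s by have [k ->] := sS m; exists k%:A.
have [|t tP] := cyclic_Ext1_extension (g := fun y => (l y)%:A *: s) ext_s gens.
  move=> b y z /corner_radical_ann Ky /corner_radical_ann Kz.
  have [c Kc] := top b.
  have lby : l (b * y) = c * l y.
    apply/eqP; have /eqP := lJ _ (KKJ _ _ Kc Ky).
    by rewrite mulrBl mulr_algl linearB linearZ /= subr_eq0.
  rewrite linearD /= lby scalerDl scalerDl alg_scaleC; congr (_ + _).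
  have -> : b *: s = c%:A *: s.
    by apply/eqP; rewrite -subr_eq0 -scalerBl; apply/eqP/corner_radical_ann.
  by rewrite scalerA mulr_algl scalerA mulrC.
have [k tk] := sS t; case/eqP: s0.
have xs : x *: s = 0 by apply/corner_radical_ann.
by have := tP x xs; rewrite tk alg_scaleC xs scaler0 lx scale1r scale1r.
Qed.

End Generation.

Section Main.
Variables (F : fieldType) (A : falgType F) (e : A).

Lemma zad_top_character p : zad (Ae_mod_Re e) -> primitive p ->
    e * p = p -> p * e = p ->
  forall a, exists c : F, corner_radical p ((a - c%:A) * p).
Proof.
move=> zV prim ep pe a; have [pp _ _] := prim.
pose q := quot_pi (Submodule (@Re_closed _ _ e)).
have surj (w : Ae_mod_Re e) : exists u, q u = w by elim/quot_piP: w => u; exists u.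
have [c [i [k [Ii qk ap]]]] := zad_primitive_corner surj zV prim ep pe a.
have [r Rr rk] : rtrans (jacobson A) e (sub_mod_val k).
  have : q k == q 0 by apply/eqP; rewrite [RHS]linear0.
  by rewrite quot_piE subr0 !inE.
exists c, (i * p), r; split=> //; first exact: comm_idealMr.
rewrite mulrBl mulr_algl -{1}pp mulrA ap -rk !mulrDl -scalerAl pp -mulrA ep.
by rewrite [LHS]addrC -!addrA addKr.
Qed.

Lemma generated_of_Ext1 : e * e = e -> zad (Ae_mod_Re e) ->
  (forall N : submodule (Ae e),
     one_dimensional (quot_mod N) -> Ext1_eq0 (quot_mod N) (quot_mod N)) ->
  rtrans setT e = rtrans (idem_subalg A) e.
Proof.
move=> ee zV ext.
suff EAe a : idem_subalg A (a * e).
  apply/seteqP; split=> _ [a aE <-]; last by exists a.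
  by exists (a * e) => //; rewrite -mulrA ee.
move: a; pose P p := forall a, idem_subalg A (a * p).
apply: (@idempotent_induction _ _ P _ ee).
- by move=> a; rewrite mulr0; apply: idem_subalg0.
- by move=> p q Ep Eq a; rewrite mulrDr; apply: idem_subalgD.
move=> p prim ep pe a; have [pp _ _] := prim.
have [Ip|nIp] := pselect (comm_ideal A p).
  by apply: comm_ideal_sub_idem_subalg; apply: left_idealM (comm_ideal_left A) Ip.
exact: (corner_generated pp pe nIp (zad_top_character zV prim ep pe) ext).
Qed.

End Main.

Theorem theorem3p6 (F : fieldType) (A : falgType F) (e : A) (he : e * e = e) :
  [<-> zad (Ae e);
       zad (Ae_mod_Re e) /\ rtrans (jacobson A) e `<=` rtrans (comm_ideal A) e;
       zad (Ae_mod_Re e) /\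
         (forall N : submodule (Ae e),
            one_dimensional (quot_mod N) -> Ext1_eq0 (quot_mod N) (quot_mod N));
       rtrans setT e = rtrans (idem_subalg A) e].
Proof.
tfae=> [zV|[zV ReIe]|[zV ext]|eqAE].
- split; last exact: zad_radical_sub.
  apply: (zad_quotient (g := quot_pi (Submodule (@Re_closed _ _ e)))) zV => w.
  by elim/quot_piP: w => u; exists u.
- by split=> // N; apply: quotient_Ext1_eq0.
- exact: generated_of_Ext1.
- exact: zad_of_generated.
Qed.
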